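(* Let $H$ be a complex Hilbert space, let $A\in B(H)$ be a positive (semidefinite) operator, and let $T_1,T_2\in B_{A^{1/2}}(H)$. Then $$\sigma_{(A\otimes A)_{app}}(T_1\odot I)=\sigma_{A_{app}}(T_1)\quad\text{and}\quad \sigma_{(A\otimes A)_{app}}(I\odot T_2)=\sigma_{A_{app}}(T_2),$$ where $I$ is the identity operator on $H$.
   Context: $B(H)$ is the algebra of bounded linear operators on $H$; $R(\cdot)$ denotes range. $\|x\|_A=\langle Ax,x\rangle^{1/2}$. $B_{A^{1/2}}(H)=\{T\in B(H): R(T^*A^{1/2})\subset R(A^{1/2})\}$ (equivalently, there is $d>0$ with $\|Tx\|_A\le d\|x\|_A$ for all $x\in H$). For $T\in B(H)$, $\sigma_{A_{app}}(T)$ is the set of $\lambda\in\mathbb C$ for which there is a sequence $\{x_n\}$ in $H$ with $\|x_n\|_A=1$ for all $n$ and $\|(T-\lambda)x_n\|_A\to0$. $H\odot H$ is the algebraic tensor product (linear span of elementary tensors $x\otimes y$) with the inner product determined by $(x\otimes y,x'\otimes y')=\langle x,x'\rangle\langle y,y'\rangle$; $H\otimes H$ is its completion. For $S_1,S_2\in B(H)$, $S_1\odot S_2$ is the linear operator on $H\odot H$ with $(S_1\odot S_2)(x\otimes y)=S_1x\otimes S_2y$, and $S_1\otimes S_2$ is its bounded extension to $H\otimes H$. For $u\in H\otimes H$, $\|u\|_{A\otimes A}=((A\otimes A)u,u)^{1/2}$. For a bounded operator $V$ on $H\odot H$, $\sigma_{(A\otimes A)_{app}}(V)$ is the set of $\lambda\in\mathbb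 C$ for which there is a sequence $\{u_n\}$ in $H\odot H$ with $\|u_n\|_{A\otimes A}=1$ for all $n$ and $\|(V-\lambda)u_n\|_{A\otimes A}\to0$. *)

(* Defs.v *)
From HB Require Import structures.
From mathcomp Require Import all_boot all_order all_algebra.
From mathcomp Require Import complex.
From mathcomp Require Import all_classical all_reals all_analysis.

Set Implicit Arguments.
Unset Strict Implicit.
Unset Printing Implicit Defensive.

Import Order.TTheory GRing.Theory Num.Theory Num.Def.
Import numFieldNormedType.Exports.

Local Open Scope classical_set_scope.
Local Open Scope ring_scope.

(* A complex Hilbert space is given by [H : completeNormedModType R[i]] and    *)
(* [dot : {dot H for conjC}] (linear in its first argument) such that          *)
(* [`|x| ^+ 2 = dot x x]. In this library norms take their values in [R[i]].   *)
Section Operators.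
Context {R : realType} {H : completeNormedModType R[i]}.
Variable dot : {dot H for (@conjC R[i])}.

Definition bounded_operator (T : H -> H) : Prop :=
  exists M : R[i], forall x, `|T x| <= M * `|x|.

(* The order of [R[i]] makes [0 <= z] mean that z is real and nonnegative. *)
Definition positive_operator (T : H -> H) : Prop :=
  forall x, 0 <= dot (T x) x.

Definition is_adjoint (T T' : H -> H) : Prop :=
  forall x y, dot (T x) y = dot x (T' y).

Definition is_sqrt_operator (A S : H -> H) : Prop :=
  [/\ bounded_operator S, positive_operator S & forall x, S (S x) = A x].

(* T belongs to $B_{A^{1/2}}(H)$; the square root [S] of a positive A and the  *)
(* adjoint [T'] of T are unique, so it does not matter how they are bound.     *)
Definition in_B_sqrt (A T : H -> H) : Prop :=
  bounded_operator T /\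
  exists S T' : {linear H -> H},
    [/\ is_sqrt_operator A S, bounded_operator T', is_adjoint T T'
      & range (T' \o S) `<=` range S].

End Operators.

(* For E := H, form := dot these are $\|\cdot\|_A$ and $\sigma_{A_{app}}$. For *)
(* E := tensor H, form := tensor_dot dot and tensor_op A A in place of A they  *)
(* are $\|\cdot\|_{A \otimes A}$ on $H \odot H$ and                           *)
(* $\sigma_{(A \otimes A)_{app}}$; see [A_norm_completion].                    *)
Section ApproximateSpectrum.
Context {R : realType} {E : lmodType R[i]}.
Variables (form : E -> E -> R[i]) (A : E -> E).

Definition A_norm (x : E) : R[i] := sqrtC (form (A x) x).

Definition approx_spectrum (T : E -> E) : set R[i] :=
  [set l | exists x_ : nat -> E,
    (forall n, A_norm (x_ n) = 1) /\
    ((fun n => A_norm (T (x_ n) - l *: x_ n) : R[i]^o) @ \oo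
       --> (0 : R[i]^o))].

End ApproximateSpectrum.

(* The algebraic tensor product of V with itself, realized as the linear span  *)
(* of the elementary tensors $x \otimes y : b \mapsto b(x, y)$ in the dual of  *)
(* the space of bilinear forms on V.                                           *)
Section AlgebraicTensor.
Context {C : numClosedFieldType} {V : lmodType C}.
Implicit Types (b : {biscalar V}) (u v : {biscalar V} -> C).

Definition elem_functional (x y : V) : {biscalar V} -> C := fun b => b x y.

Definition tensor_span : pred ({biscalar V} -> C) := fun u =>
  `[< exists s : seq (V * V), u = \sum_(p <- s) elem_functional p.1 p.2 >].

Lemma tensor_span_submod : submod_closed tensor_span.
Proof.
split=> [|a u v /asboolP [s ->] /asboolP [t ->]]; apply/asboolP.
  by exists [::]; rewrite big_nil.
exists ([seq (a *: p.1, p.2) | p <- s] ++ t).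
rewrite big_cat big_map /= scaler_sumr; congr (_ + _).
by apply: eq_bigr => p _; apply/funext => b; rewrite /elem_functional linearZl_LR.
Qed.

HB.instance Definition _ :=
  GRing.isSubmodClosed.Build C ({biscalar V} -> C) tensor_span
    tensor_span_submod.

End AlgebraicTensor.


Section TensorType.
Context (C : numClosedFieldType) (V : lmodType C).

Record tensor : Type := Tensor {
  tensor_val : {biscalar V} -> C;
  tensor_valP : tensor_val \in @tensor_span C V }.

HB.instance Definition _ := [isSub for tensor_val].
HB.instance Definition _ := [Choice of tensor by <:].
HB.instance Definition _ := [SubChoice_isSubLmodule of tensor by <:].

Lemma elem_tensor_subproof (x y : V) :
  elem_functional x y \in @tensor_span C V.
Proof. by apply/asboolP; exists [:: (x, y)]; rewrite big_seq1. Qed.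

Definition elem_tensor (x y : V) : tensor := Tensor (elem_tensor_subproof x y).

Lemma tensor_valE (s : seq (V * V)) :
  tensor_val (\sum_(p <- s) elem_tensor p.1 p.2) =
  \sum_(p <- s) elem_functional p.1 p.2.
Proof.
by elim/big_rec2: _ => // p y1 y2 _ <-.
Qed.

Lemma tensor_sum (u : tensor) :
  exists s : seq (V * V), u = \sum_(p <- s) elem_tensor p.1 p.2.
Proof.
case: u => u uP; have /asboolP[s us] := uP; exists s.
by apply/val_inj; rewrite /= tensor_valE.
Qed.

Lemma tensor_sumE (s : seq (V * V)) (b : {biscalar V}) :
  tensor_val (\sum_(p <- s) elem_tensor p.1 p.2) b = \sum_(p <- s) b p.1 p.2.
Proof. by rewrite tensor_valE fct_sumE. Qed.

Lemma tensor_valD (u v : tensor) (b : {biscalar V}) :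
  tensor_val (u + v) b = tensor_val u b + tensor_val v b.
Proof. by []. Qed.

(* The operator $S_1 \odot S_2$, by precomposition of bilinear forms. *)
Section TensorOp.
Variables S1 S2 : {linear V -> V}.

Definition bilin_comp (b : {biscalar V}) (x y : V) : C := b (S1 x) (S2 y).

Lemma bilin_comp_bilinear (b : {biscalar V}) :
  bilinear_for ( *%R : GRing.Scale.law C C) *%R (bilin_comp b).
Proof.
split=> [y a x x'|x a y y']; rewrite /bilin_comp linearP.
  by rewrite linearDl linearZl_LR.
by rewrite linearDr linearZr_LR.
Qed.

HB.instance Definition _ (b : {biscalar V}) :=
  bilinear_isBilinear.Build C V V C *%R *%R (bilin_comp b)
    (bilin_comp_bilinear b).

Lemma tensor_op_subproof (u : tensor) :
  (fun b : {biscalar V} => tensor_val u (bilin_comp b)) \in @tensor_span C V.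
Proof.
have [s ->] := tensor_sum u; apply/asboolP.
exists [seq (S1 p.1, S2 p.2) | p <- s]; apply/funext => b.
by rewrite tensor_sumE big_map fct_sumE.
Qed.

Definition tensor_op (u : tensor) : tensor := Tensor (tensor_op_subproof u).

Lemma tensor_op_is_linear : linear tensor_op.
Proof. by move=> a u v; apply/val_inj. Qed.

HB.instance Definition _ :=
  GRing.isLinear.Build C tensor tensor *:%R tensor_op tensor_op_is_linear.

Lemma tensor_opE (x y : V) :
  tensor_op (elem_tensor x y) = elem_tensor (S1 x) (S2 y).
Proof. exact/val_inj. Qed.

End TensorOp.

(* [tensor_dot] is the sesquilinear form on the algebraic tensor product with  *)
(* $(x \otimes y, x' \otimes y') = \langle x, x' \rangle \langle y, y' \rangle$ *)
(* (lemma [tensor_dotE]). *)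
Section TensorDot.
Variable dot : {dot V for (@conjC C)}.

Let form_conjC (x y : V) : dot x y = conjC (dot y x).
Proof. by rewrite (hermitian_subproof x y) expr0 mul1r. Qed.

Definition dot_form (x y x' y' : V) : C := dot x' x * dot y' y.

Lemma dot_form_bilinear (x y : V) :
  bilinear_for ( *%R : GRing.Scale.law C C) *%R (dot_form x y).
Proof.
split=> [y' a z z'|x' a z z']; rewrite /dot_form linearDl linearZl_LR.
  by rewrite mulrDl -mulrA.
by rewrite mulrDr mulrCA.
Qed.

HB.instance Definition _ (x y : V) :=
  bilinear_isBilinear.Build C V V C *%R *%R (dot_form x y)
    (dot_form_bilinear x y).

Definition dot_with (v : tensor) (x y : V) : C :=
  conjC (tensor_val v (dot_form x y)).

Lemma dot_with_sum (s : seq (V * V)) (x y : V) :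
  dot_with (\sum_(p <- s) elem_tensor p.1 p.2) x y =
  \sum_(p <- s) dot x p.1 * dot y p.2.
Proof.
rewrite /dot_with tensor_sumE rmorph_sum; apply: eq_bigr => p _.
by rewrite /dot_form rmorphM /= -!form_conjC.
Qed.

Lemma dot_with_bilinear (v : tensor) :
  bilinear_for ( *%R : GRing.Scale.law C C) *%R (dot_with v).
Proof.
have [s ->] := tensor_sum v.
split=> [y a z z'|x a z z']; rewrite !dot_with_sum /= mulr_sumr -big_split /=;
  apply: eq_bigr => p _; rewrite linearDl linearZl_LR.
  by rewrite mulrDl -mulrA.
by rewrite mulrDr mulrCA.
Qed.

HB.instance Definition _ (v : tensor) :=
  bilinear_isBilinear.Build C V V C *%R *%R (dot_with v)
    (dot_with_bilinear v).

Definition tensor_dot (u v : tensor) : C := tensor_val u (dot_with v).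

Lemma tensor_dot_sum (s t : seq (V * V)) :
  tensor_dot (\sum_(p <- s) elem_tensor p.1 p.2)
             (\sum_(q <- t) elem_tensor q.1 q.2) =
  \sum_(p <- s) \sum_(q <- t) dot p.1 q.1 * dot p.2 q.2.
Proof.
by rewrite /tensor_dot tensor_sumE; apply: eq_bigr => p _; exact: dot_with_sum.
Qed.

Lemma tensor_dotE (x y x' y' : V) :
  tensor_dot (elem_tensor x y) (elem_tensor x' y') = dot x x' * dot y y'.
Proof.
by have := tensor_dot_sum [:: (x, y)] [:: (x', y')]; rewrite !big_seq1.
Qed.

Lemma tensor_dotC (u v : tensor) : tensor_dot u v = conjC (tensor_dot v u).
Proof.
have [s ->] := tensor_sum u; have [t ->] := tensor_sum v.
rewrite !tensor_dot_sum rmorph_sum exchange_big /=; apply: eq_bigr => q _.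
rewrite rmorph_sum; apply: eq_bigr => p _; rewrite rmorphM.
by congr (_ * _); exact: form_conjC.
Qed.

Lemma tensor_dot_linearl (v : tensor) (a : C) (u u' : tensor) :
  tensor_dot (a *: u + u') v = a * tensor_dot u v + tensor_dot u' v.
Proof. by []. Qed.

Lemma tensor_dot_sesquilinear :
  bilinear_for ( *%R : GRing.Scale.law C C) (conjC \; *%R) tensor_dot.
Proof.
split=> [v a u u'|u a v v']; first exact: tensor_dot_linearl.
by rewrite tensor_dotC tensor_dot_linearl rmorphD rmorphM /= -!tensor_dotC.
Qed.

HB.instance Definition _ :=
  bilinear_isBilinear.Build C tensor tensor C *%R (conjC \; *%R) tensor_dot
    tensor_dot_sesquilinear.

Lemma tensor_dot_hermitian (u v : tensor) :
  tensor_dot u v = (-1) ^+ false * conjC (tensor_dot v u).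
Proof. by rewrite expr0 mul1r -tensor_dotC. Qed.

HB.instance Definition _ :=
  isHermitianSesquilinear.Build C tensor false conjC tensor_dot
    tensor_dot_hermitian.

(* Gram-Schmidt on the right factors. *)
Lemma tensor_orthogonal_sum (u : tensor) :
  exists2 s : seq (V * V), u = \sum_(p <- s) elem_tensor p.1 p.2 &
    all (fun p => p.2 != 0) s && pairwise (fun p q => dot p.2 q.2 == 0) s.
Proof.
have [s ->] := tensor_sum u; elim: s => [|[x y] s [t ts /andP[t0 tP]]].
  by exists [::]; rewrite ?big_nil.
rewrite big_cons {}ts /=.
pose c (p : V * V) := dot y p.2 / dot p.2 p.2.
pose r := y - \sum_(p <- t) c p *: p.2.
pose t' := [seq (p.1 + c p *: x, p.2) | p <- t].
have t'0 : all (fun p => p.2 != 0) t' by rewrite all_map.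
have t'P : pairwise (fun p q => dot p.2 q.2 == 0) t' by rewrite pairwise_map.
have tt' : elem_tensor x y + \sum_(p <- t) elem_tensor p.1 p.2 =
    elem_tensor x r + \sum_(p <- t') elem_tensor p.1 p.2.
  apply/val_inj/funext => b; rewrite -![val _]/(tensor_val _).
  rewrite !tensor_valD !tensor_sumE /= /elem_functional big_map /=.
  rewrite linearBr linear_sumr -addrA; congr (_ + _).
  rewrite addrC -sumrB; apply: eq_bigr => p _.
  by rewrite linearDl linearZl_LR linearZr_LR addrK.
have [r0|r0] := eqVneq r 0.
  exists t'; last by rewrite t'0.
  rewrite tt' (_ : elem_tensor x r = 0) ?add0r//.
  by apply/val_inj/funext => b; rewrite r0; exact: linear0r.
exists ((x, r) :: t'); first by rewrite big_cons.
rewrite /= r0 /= t'P andbT t'0 /= all_map; apply/allP => q qt /=.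
rewrite linearBl linear_sumlz subr_eq0.
have q0 : dot q.2 q.2 != 0.
  by rewrite gt_eqF// neq0_dnorm_gt0// (allP t0).
suff -> : \sum_(p <- t) dot (c p *: p.2) q.2 = c q * dot q.2 q.2.
  by rewrite /c divfK.
have IHt : q \in t -> pairwise (fun p q => dot p.2 q.2 == 0) t ->
    \sum_(p <- t) dot (c p *: p.2) q.2 = c q * dot q.2 q.2; last exact: IHt.
clear -q form_conjC; elim: t => // p t IH; rewrite inE big_cons /= linearZl_LR.
move=> qpt /andP[pt tP].
have [qt|qt] := boolP (q \in t).
  by rewrite IH// [X in _ * X](eqP (allP pt _ qt)) mulr0 add0r.
move: qpt; rewrite (negPf qt) orbF => /eqP qp; rewrite qp.
rewrite big_seq big1 ?addr0// => p' p't; rewrite linearZl_LR.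
by rewrite [X in _ * X]form_conjC (eqP (allP pt _ p't)) rmorph0 mulr0.
Qed.

Lemma tensor_dot_gt0 (u : tensor) : u != 0 -> 0 < tensor_dot u u.
Proof.
have dot_ge0 x : 0 <= dot x x.
  by have [->|x0] := eqVneq x 0; [rewrite linear0l|exact/ltW/neq0_dnorm_gt0].
have [s -> /andP[s0 sP]] := tensor_orthogonal_sum u => u0.
have -> : tensor_dot (\sum_(p <- s) elem_tensor p.1 p.2)
    (\sum_(p <- s) elem_tensor p.1 p.2) =
    \sum_(p <- s) dot p.1 p.1 * dot p.2 p.2.
  rewrite tensor_dot_sum; elim: {s0 u0} s sP => [|p s IH] /=; rewrite ?big_nil//.
  move=> /andP[ps /IH {}IH]; rewrite !big_cons -IH.
  rewrite [X in _ + X + _]big_seq big1 ?addr0; last first.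
    by move=> q qs; rewrite (eqP (allP ps _ qs)) mulr0.
  congr (_ + _); rewrite big_seq [RHS]big_seq; apply: eq_bigr => q qs.
  by rewrite big_cons form_conjC [X in _ * X]form_conjC (eqP (allP ps _ qs))
    rmorph0 mulr0 add0r.
elim: {sP} s s0 u0 => [|p s IH] /=; rewrite ?big_nil ?eqxx// !big_cons.
move=> /andP[p0 s0] u0.
have sge0 : 0 <= \sum_(q <- s) dot q.1 q.1 * dot q.2 q.2.
  by apply: sumr_ge0 => q _; rewrite mulr_ge0.
have [p10|p10] := eqVneq p.1 0; last first.
  by rewrite ltr_wpDr// mulr_gt0 ?neq0_dnorm_gt0.
rewrite p10 linear0l mul0r add0r IH//; apply: contra u0 => /eqP ->.
by rewrite addr0 p10; apply/eqP/val_inj/funext => b; exact: linear0l.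
Qed.

HB.instance Definition _ := isDotProduct.Build C tensor tensor_dot tensor_dot_gt0.

End TensorDot.

End TensorType.

(* On the algebraic tensor product, $A \otimes A$ acts as $A \odot A$ and the  *)
(* inner product of the completion is [tensor_dot dot]. Hence in any           *)
(* realization [K] of $H \otimes H$ the seminorm $\|u\|_{A \otimes A}$ of an   *)
(* element u of $H \odot H$ is                                                 *)
(* [A_norm (tensor_dot dot) (tensor_op A A) u].                                *)
Lemma A_norm_completion (R : realType) (H K : lmodType R[i])
    (dot : {dot H for (@conjC R[i])}) (dotK : {dot K for (@conjC R[i])})
    (A : {linear H -> H}) (iota : tensor H -> K) (AA : K -> K) :
  (forall u v, dotK (iota u) (iota v) = tensor_dot dot u v) ->
  (forall u, AA (iota u) = iota (tensor_op A A u)) ->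
  forall u, A_norm dotK AA (iota u) = A_norm (tensor_dot dot) (tensor_op A A) u.
Proof. by move=> iotaE AAE u; rewrite /A_norm AAE iotaE. Qed.

(* Main.v *)
Require Import Defs.
From HB Require Import structures.
From mathcomp Require Import all_boot all_order all_algebra.
From mathcomp Require Import complex.
From mathcomp Require Import ring.
From mathcomp Require Import all_classical all_reals all_analysis.

(* Write [|x|_A = |S x|] with [S] the square root of [A]. If [l] is not in the *)
(* A-approximate spectrum of [T], then some [c > 0] satisfies                  *)
(* [c |x|_A <= |(T - l) x|_A] for all [x]. Decomposing [(I \odot S) u] as      *)
(* [\sum_i x_i \otimes z_i] with orthogonal [z_i], one has                     *)
(* [|(X \odot S) u|^2 = \sum_i |X x_i|^2 |z_i|^2] for [X = S] and              *)
(* [X = S (T - l)], so the same [c] bounds [(T - l) \odot I] from below on the *)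
(* tensor product. Conversely, tensoring an approximate eigensequence with a   *)
(* fixed A-unit vector gives one for [T \odot I]. The flip                     *)
(* [x \otimes y -> y \otimes x] exchanges the two equalities.                  *)

Set Implicit Arguments.
Unset Strict Implicit.
Unset Printing Implicit Defensive.

Import Order.TTheory GRing.Theory Num.Theory Num.Def.
Import numFieldNormedType.Exports.

Local Open Scope classical_set_scope.
Local Open Scope ring_scope.

(** [positive_self_adjoint] turns both seminorms into norms of [S x] and [(S \odot S) u]. The
    inclusion of the tensor spectrum in that of [T] is by contraposition: [approx_spectrum_ge] gives
    a lower bound for [T - l], and [tensor_op_lower_bound] carries it to the tensor product, where
    it excludes approximate eigensequences. [approx_spectrum_tensor] joins this with the converse,
    and [approx_spectrum_swap] moves the result to the right factor. *)

Section TensorCalculus.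
Context {C : numClosedFieldType} {V : lmodType C}.

(** Tensors are functionals on bilinear forms, so the flip is precomposition with this exchange of
    arguments and needs no choice of representatives. *)
Definition bilin_swap (b : {biscalar V}) (x y : V) : C := b y x.

Lemma bilin_swap_bilinear (b : {biscalar V}) :
  bilinear_for ( *%R : GRing.Scale.law C C) *%R (bilin_swap b).
Proof.
split=> [y a x x'|x a y y']; rewrite /bilin_swap.
  by rewrite linearDr linearZr_LR.
by rewrite linearDl linearZl_LR.
Qed.

HB.instance Definition _ (b : {biscalar V}) :=
  bilinear_isBilinear.Build C V V C *%R *%R (bilin_swap b)
    (bilin_swap_bilinear b).

Lemma tensor_swap_subproof (u : tensor V) :
  (fun b : {biscalar V} => tensor_val u (bilin_swap b)) \in @tensor_span C V.
Proof.
have [s ->] := tensor_sum u; apply/asboolP.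
exists [seq (p.2, p.1) | p <- s]; apply/funext => b.
by rewrite tensor_sumE big_map fct_sumE.
Qed.

Definition tensor_swap (u : tensor V) : tensor V :=
  Tensor (tensor_swap_subproof u).

Lemma tensor_swap_is_linear : linear tensor_swap.
Proof. by move=> a u v; apply/val_inj. Qed.

HB.instance Definition _ :=
  GRing.isLinear.Build C (tensor V) (tensor V) *:%R tensor_swap
    tensor_swap_is_linear.

Lemma tensor_swap_sub_scale (l : C) (u v : tensor V) :
  tensor_swap (u - l *: v) = tensor_swap u - l *: tensor_swap v.
Proof. by rewrite linearB linearZ. Qed.

Lemma tensor_swap_elem (x y : V) :
  tensor_swap (elem_tensor x y) = elem_tensor y x.
Proof. exact/val_inj. Qed.

Section Sums.
Variables (I : Type) (s : seq I) (f g : I -> V).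

Lemma tensor_op_sum (S1 S2 : {linear V -> V}) :
  tensor_op S1 S2 (\sum_(i <- s) elem_tensor (f i) (g i)) =
  \sum_(i <- s) elem_tensor (S1 (f i)) (S2 (g i)).
Proof. by rewrite linear_sum; apply: eq_bigr => i _; exact: tensor_opE. Qed.

Lemma tensor_swap_sum :
  tensor_swap (\sum_(i <- s) elem_tensor (f i) (g i)) =
  \sum_(i <- s) elem_tensor (g i) (f i).
Proof.
by rewrite linear_sum; apply: eq_bigr => i _; exact: tensor_swap_elem.
Qed.

Lemma tensor_dot_sumE (dot : {dot V for (@conjC C)})
    (J : Type) (t : seq J) (f' g' : J -> V) :
  tensor_dot dot (\sum_(i <- s) elem_tensor (f i) (g i))
                 (\sum_(j <- t) elem_tensor (f' j) (g' j)) =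
  \sum_(i <- s) \sum_(j <- t) dot (f i) (f' j) * dot (g i) (g' j).
Proof.
by have := tensor_dot_sum dot [seq (f i, g i) | i <- s]
  [seq (f' j, g' j) | j <- t]; rewrite !big_map => ->; apply: eq_bigr => i _;
  rewrite big_map.
Qed.

End Sums.

Lemma tensor_swap_op (S1 S2 : {linear V -> V}) (u : tensor V) :
  tensor_swap (tensor_op S1 S2 u) = tensor_op S2 S1 (tensor_swap u).
Proof.
by have [s ->] := tensor_sum u; rewrite tensor_op_sum !tensor_swap_sum
  tensor_op_sum.
Qed.

Lemma tensor_op_id (u : tensor V) : tensor_op idfun idfun u = u.
Proof. by have [s ->] := tensor_sum u; rewrite tensor_op_sum. Qed.

Lemma tensor_op_factor (P Q : {linear V -> V}) (u : tensor V) :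
  tensor_op P Q u = tensor_op P idfun (tensor_op idfun Q u).
Proof. by have [s ->] := tensor_sum u; rewrite !tensor_op_sum. Qed.

Lemma tensor_op_comp_factor (P Q T : {linear V -> V}) (u : tensor V) :
  tensor_op P Q (tensor_op T idfun u) =
  tensor_op (P \o T) idfun (tensor_op idfun Q u).
Proof. by have [s ->] := tensor_sum u; rewrite !tensor_op_sum. Qed.

Lemma tensor_op_sub_scale (T S : {linear V -> V}) (l : C) (u : tensor V) :
  tensor_op (T \- (l \*: S)) idfun u =
  tensor_op T idfun u - l *: tensor_op S idfun u.
Proof.
have [s ->] := tensor_sum u; rewrite !tensor_op_sum scaler_sumr -sumrB.
apply: eq_bigr => p _; apply/val_inj/funext => b.
by rewrite /= /elem_functional linearBl linearZl_LR.
Qed.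

(** * Inner product estimates on the tensor product *)

Variable dot : {dot V for (@conjC C)}.

Lemma tensor_dot_swap (u v : tensor V) :
  tensor_dot dot (tensor_swap u) (tensor_swap v) = tensor_dot dot u v.
Proof.
have [s ->] := tensor_sum u; have [t ->] := tensor_sum v.
rewrite !tensor_swap_sum !tensor_dot_sumE.
by apply: eq_bigr => p _; apply: eq_bigr => q _; rewrite mulrC.
Qed.

Lemma dot_ge0 (x : V) : 0 <= dot x x.
Proof.
by have [->|x0] := eqVneq x 0; [rewrite linear0l|exact/ltW/neq0_dnorm_gt0].
Qed.

Lemma dot_conj (x y : V) : dot x y = (dot y x)^*.
Proof. by rewrite (hermitian_subproof x y) expr0 mul1r. Qed.

(** Polarization: the defect [g] of self-adjointness is sesquilinear and zero on the diagonal.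
    Expanding it at [x + y] makes it skew, at [x + 'i *: y] symmetric, hence zero. *)
Lemma positive_self_adjoint (S : {linear V -> V}) :
  (forall x, 0 <= dot (S x) x) -> forall x y, dot (S x) y = dot x (S y).
Proof.
move=> S0 x y; apply/eqP; rewrite -subr_eq0; apply/eqP.
pose g z w := dot (S z) w - dot z (S w).
have gzz z : g z z = 0.
  apply/eqP; rewrite subr_eq0 [eqbRHS]dot_conj; apply/eqP/esym.
  by apply/CrealP; rewrite ger0_real.
have g_skew : g x y + g y x = 0.
  have := gzz (x + y); rewrite /g linearD !linearDl !linearDr /= => <-.
  have := gzz x; have := gzz y; rewrite /g => /eqP + /eqP.
  by rewrite !subr_eq0 => /eqP -> /eqP ->; ring.
have g_sym : g y x = g x y.
  have := gzz (x + 'i *: y); have := gzz x; have := gzz y.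
  rewrite /g linearD linearZ !linearDl !linearDr /= !linearZl_LR !linearZr_LR /=.
  rewrite conjCi => /eqP + /eqP; rewrite !subr_eq0 => /eqP -> /eqP -> h.
  apply: (mulfI (neq0Ci C)); apply/eqP; rewrite -subr_eq0; apply/eqP.
  by rewrite -h; ring.
by move: g_skew; rewrite g_sym -mulr2n => /eqP; rewrite mulrn_eq0 => /eqP.
Qed.

(** Once the right factors are orthogonal, all cross terms vanish, for [P] and [Q] alike, and the
    two squared norms compare term by term. *)
Lemma tensor_op_lower_bound (P Q : {linear V -> V}) (c : C) :
  (forall x, c * dot (P x) (P x) <= dot (Q x) (Q x)) ->
  forall u, c * tensor_dot dot (tensor_op P idfun u) (tensor_op P idfun u) <=
    tensor_dot dot (tensor_op Q idfun u) (tensor_op Q idfun u).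
Proof.
move=> PQ u; have [s -> /andP[_ sP]] := tensor_orthogonal_sum dot u.
have E (S : {linear V -> V}) :
    tensor_dot dot (tensor_op S idfun (\sum_(p <- s) elem_tensor p.1 p.2))
      (tensor_op S idfun (\sum_(p <- s) elem_tensor p.1 p.2)) =
    \sum_(p <- s) dot (S p.1) (S p.1) * dot p.2 p.2.
  rewrite tensor_op_sum tensor_dot_sumE.
  elim: {u} s sP => [|p s IH] /=; rewrite ?big_nil//.
  move=> /andP[ps /IH {}IH]; rewrite !big_cons -IH.
  rewrite [X in _ + X + _]big_seq big1 ?addr0; last first.
    by move=> q qs; rewrite (eqP (allP ps _ qs)) mulr0.
  congr (_ + _); rewrite big_seq [RHS]big_seq; apply: eq_bigr => q qs.
  by rewrite big_cons [X in _ * X + _]dot_conj (eqP (allP ps _ qs)) rmorph0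
    mulr0 add0r.
rewrite !E mulr_sumr; apply: ler_sum => p _.
by rewrite mulrA ler_wpM2r ?dot_ge0.
Qed.

(** [tensor_op S S] is a self-adjoint square root of [tensor_op A A]. *)
Lemma tensor_dot_op_sqrt (A S : {linear V -> V}) :
  (forall x y, dot (S x) y = dot x (S y)) -> (forall x, S (S x) = A x) ->
  forall u, tensor_dot dot (tensor_op A A u) u =
    tensor_dot dot (tensor_op S S u) (tensor_op S S u).
Proof.
move=> Sadj SS u; have [s ->] := tensor_sum u.
rewrite !tensor_op_sum !tensor_dot_sumE.
by apply: eq_bigr => p _; apply: eq_bigr => q _; rewrite -!SS !Sadj.
Qed.

End TensorCalculus.

(** * Approximate spectra: flip, lower bounds, tensor products *)

Lemma approx_spectrum_swap {R : realType} {V : lmodType R[i]}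
    (dot : {dot V for (@conjC R[i])}) (A T : {linear V -> V}) :
  approx_spectrum (tensor_dot dot) (tensor_op A A) (tensor_op idfun T) =
  approx_spectrum (tensor_dot dot) (tensor_op A A) (tensor_op T idfun).
Proof.
have norm_swap u : A_norm (tensor_dot dot) (tensor_op A A) (tensor_swap u) =
    A_norm (tensor_dot dot) (tensor_op A A) u.
  by rewrite /A_norm -tensor_swap_op tensor_dot_swap.
(* The flip preserves the seminorm and intertwines the two operators. Stated for arbitrary [S1] and
   [S2], one inclusion yields both. *)
have sub (S1 S2 : {linear V -> V}) :
    approx_spectrum (tensor_dot dot) (tensor_op A A) (tensor_op S1 S2) `<=`
    approx_spectrum (tensor_dot dot) (tensor_op A A) (tensor_op S2 S1).
  move=> l [u [u1 ul]]; exists (fun n => tensor_swap (u n)).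
  split=> [n|]; first by rewrite norm_swap.
  have E n : A_norm (tensor_dot dot) (tensor_op A A)
        (tensor_op S2 S1 (tensor_swap (u n)) - l *: tensor_swap (u n)) =
      A_norm (tensor_dot dot) (tensor_op A A) (tensor_op S1 S2 (u n) - l *: u n).
    by rewrite -[RHS]norm_swap tensor_swap_sub_scale tensor_swap_op.
  by rewrite (funext E).
by apply/seteqP; split; exact: sub.
Qed.

Lemma near_infty_natSinv_ltC {R : realType} (e : R[i]) :
  0 < e -> \forall n \near \oo, n.+1%:R^-1 < e.
Proof.
case: e => a b; rewrite ltcE /= => /andP[/eqP -> a0].
near=> n.
have -> : (n.+1%:R^-1 : R[i]) = (n.+1%:R^-1 : R)%:C%C.
  by rewrite fmorphV rmorph_nat.
by rewrite -[ltRHS]/(a%:C%C) ltcR; near: n; exact: near_infty_natSinv_lt (PosNum a0).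
Unshelve. all: by end_near. Qed.

Section TensorSpectrum.
Context {R : realType} {V : lmodType R[i]}.
Variable dot : {dot V for (@conjC R[i])}.
Variables (A S : {linear V -> V}).
Hypothesis Sadj : forall x y, dot (S x) y = dot x (S y).
Hypothesis SS : forall x, S (S x) = A x.

Let A_normE x : A_norm dot A x = sqrtC (dot (S x) (S x)).
Proof. by rewrite /A_norm -SS Sadj. Qed.

Let A_norm_ge0 x : 0 <= A_norm dot A x.
Proof. by rewrite A_normE sqrtC_ge0 dot_ge0. Qed.

Let A_normZ a x : A_norm dot A (a *: x) = `|a| * A_norm dot A x.
Proof.
rewrite !A_normE linearZ linearZl_LR linearZr_LR /= mulrA -normCK.
by rewrite sqrtCM ?nnegrE ?exprn_ge0 ?dot_ge0// sqrCK.
Qed.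

Lemma approx_spectrum_ge (T : {linear V -> V}) (l : R[i]) :
  ~ approx_spectrum dot A T l ->
  exists2 c : R[i], 0 < c &
    forall x, c * A_norm dot A x <= A_norm dot A (T x - l *: x).
Proof.
move=> Tl; apply: contrapT => /forall2NP nc; apply: Tl.
have /choice[x xP] n : exists x,
    A_norm dot A (T x - l *: x) < n.+1%:R^-1 * A_norm dot A x.
  have [/negP|/existsNP[x /negP]] := nc n.+1%:R^-1.
    by rewrite invr_gt0 ltr0n.
  (* The order of [R[i]] is partial; negating the inequality is legitimate because both sides are
     real. *)
  rewrite -real_ltNge ?ger0_real ?mulr_ge0 ?invr_ge0 ?ler0n//.
  by exists x.
(* The strict inequality in [xP] keeps [x n] out of the kernel of the seminorm, so it can be
   normalized. *)
have x0 n : 0 < A_norm dot A (x n).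
  rewrite -(pmulr_rgt0 _ (_ : 0 < n.+1%:R^-1)) ?invr_gt0 ?ltr0n//.
  exact: le_lt_trans (xP n).
exists (fun n => (A_norm dot A (x n))^-1 *: x n); split=> [n|].
  by rewrite A_normZ ger0_norm ?invr_ge0// mulVf ?gt_eqF.
apply/cvgr0Pnorm_lt => e e0; near=> n.
rewrite linearZ /= scalerA [l * _]mulrC -scalerA -scalerBr A_normZ.
rewrite [X in `|X * _|]ger0_norm ?invr_ge0//.
rewrite ger0_norm ?mulr_ge0 ?invr_ge0// mulrC ltr_pdivrMr//.
apply: lt_trans (xP n) _; rewrite ltr_pM2r//.
by near: n; exact: near_infty_natSinv_ltC.
Unshelve. all: by end_near. Qed.

Lemma approx_spectrum_tensor (T : {linear V -> V}) :
  approx_spectrum (tensor_dot dot) (tensor_op A A) (tensor_op T idfun) =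
  approx_spectrum dot A T.
Proof.
have tA_normE u : A_norm (tensor_dot dot) (tensor_op A A) u =
    sqrtC (tensor_dot dot (tensor_op S S u) (tensor_op S S u)).
  by rewrite /A_norm (tensor_dot_op_sqrt Sadj SS).
apply/seteqP; split=> l [x [x1 xl]]; last first.
  (* The fixed right factor must be an A-unit vector; the sequence itself supplies one. *)
  exists (fun n => elem_tensor (x n) (x 0)).
  have E y : A_norm (tensor_dot dot) (tensor_op A A) (elem_tensor y (x 0)) =
      A_norm dot A y.
    rewrite tA_normE tensor_opE tensor_dotE sqrtCM ?nnegrE ?dot_ge0//.
    by rewrite -!A_normE x1 mulr1.
  split=> [n|]; first by rewrite E.
  have xE n : A_norm (tensor_dot dot) (tensor_op A A)
        (tensor_op T idfun (elem_tensor (x n) (x 0)) -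
         l *: elem_tensor (x n) (x 0)) =
      A_norm dot A (T (x n) - l *: x n).
    rewrite tensor_opE -E; congr A_norm; apply/val_inj/funext => b /=.
    by rewrite /elem_functional linearBl linearZl_LR.
  by rewrite (funext xE).
apply: contrapT => /approx_spectrum_ge[c c0 cT].
have {}cT u : c * A_norm (tensor_dot dot) (tensor_op A A) u <=
    A_norm (tensor_dot dot) (tensor_op A A) (tensor_op T idfun u - l *: u).
  (* Pass to squares: [tensor_op_lower_bound] compares squared norms, so its constant is
     [c ^+ 2]. *)
  rewrite !tA_normE -[leLHS]sqrCK ?mulr_ge0 ?sqrtC_ge0 ?dot_ge0 ?(ltW c0)//.
  rewrite ler_sqrtC ?nnegrE ?exprn_ge0 ?mulr_ge0 ?sqrtC_ge0 ?dot_ge0 ?(ltW c0)//.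
  rewrite exprMn sqrtCK.
  have -> : tensor_op T idfun u - l *: u =
      tensor_op (T \- (l \*: idfun)) idfun u.
    by rewrite tensor_op_sub_scale tensor_op_id.
  pose Q := [the {linear V -> V} of S \o (T \- (l \*: idfun))].
  have SQ x' : c ^+ 2 * dot (S x') (S x') <= dot (Q x') (Q x').
    rewrite -[dot (S _) _]sqrtCK -[leRHS]sqrtCK -exprMn.
    rewrite -[sqrtC (dot (Q _) _)]A_normE -A_normE.
    by rewrite ler_pXn2r ?nnegrE ?mulr_ge0// ltW.
  (* Both sides become operators on the left factor applied to the same tensor
     [tensor_op idfun S u]. *)
  rewrite [tensor_op S S u]tensor_op_factor tensor_op_comp_factor.
  exact: (tensor_op_lower_bound SQ).
(* One late term suffices: its residual is below [c] by convergence and at least [c] by [cT]. *)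
move/cvgr0Pnorm_lt: xl => /(_ c c0) [n _ /(_ n (leqnn n))] /=.
have := cT (x n); rewrite x1 mulr1 => cx.
by rewrite ger0_norm ?(le_trans (ltW c0) cx)// => /(le_lt_trans cx);
  rewrite ltxx.
Qed.

End TensorSpectrum.

Theorem theorem3p3 (R : realType) (H : completeNormedModType R[i])
    (dot : {dot H for (@conjC R[i])})
    (dot_norm : forall x : H, `|x| ^+ 2 = dot x x)
    (A : {linear H -> H}) (A_bounded : bounded_operator A)
    (A_pos : positive_operator dot A)
    (T1 T2 : {linear H -> H})
    (T1_B : in_B_sqrt dot A T1) (T2_B : in_B_sqrt dot A T2) :
  approx_spectrum (tensor_dot dot) (tensor_op A A) (tensor_op T1 idfun) =
    approx_spectrum dot A T1 /\
  approx_spectrum (tensor_dot dot) (tensor_op A A) (tensor_op idfun T2) =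
    approx_spectrum dot A T2.
Proof.
have [_ [S [_ [[_ S_pos SS] _ _ _]]]] := T1_B.
have Sadj := positive_self_adjoint S_pos.
by rewrite approx_spectrum_swap !(approx_spectrum_tensor Sadj SS).
Qed.
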